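(* The class $\mathcal{P}$ of all (finite) ordered posets is a Ramsey class. That is, for all ordered posets $P$ and $Q$ and every positive integer $r$ there exists an ordered poset $S$ such that $S \to (Q)^P_r$.
   Context: An ordered (finite) poset $P=(X,R,\leq)$ is a finite partially ordered set $(X,R)$ together with a linear extension $\leq$ of it, i.e. a linear order $\leq$ on $X$ with $R\subseteq\ \leq$. Write $X(P)=X$, $R(P)=R$, $\leq_P\,=\,\leq$. The relation $R$ is taken to be the strict (irreflexive, transitive) order relation. An embedding of an ordered poset $P$ into an ordered poset $P'$ is an injective map $f\colon X(P)\to X(P')$ such that for all $x,y\in X(P)$: $(x,y)\in R(P)\iff (f(x),f(y))\in R(P')$, and $x\leq_P y\iff f(x)\leq_{P'} f(y)$. For ordered posets $P$ and $Q$, $\binom{Q}{P}$ denotes the set of all subobjects of $Q$ isomorphic to $P$, i.e. the set of all ordered subposets of $Q$ (with both relations restricted from $Q$) that are images of embeddings of $P$ into $Q$. For ordered posets $P,Q,S$ and a positive integer $r$, $S\to (Q)^P_r$ means: for every colouring of $\binom{S}{P}$ with $r$ colours there is some $\tilde Q\in\binom{S}{Q}$ such that all elements of $\binom{\tilde Q}{P}$ have the same colour. A class $\mathcal{C}$ of such objects is a Ramsey class if for all $P,Q\in\mathcal{C}$ and every positive integer $r$ there exists $S\in\mathcal{C}$ with $S\to (Q)^P_r$. *)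

(* Defs.v *)
From mathcomp Require Import all_boot.
Set Implicit Arguments.
Unset Strict Implicit.
Unset Printing Implicit Defensive.

Record ordPoset := OrdPoset {
  vertex :> finType;
  prec : rel vertex;
  lin : rel vertex;
  prec_irr : irreflexive prec;
  prec_trans : transitive prec;
  lin_refl : reflexive lin;
  lin_anti : antisymmetric lin;
  lin_trans : transitive lin;
  lin_total : total lin;
  prec_lin : subrel prec lin
}.

Definition embedding (P Q : ordPoset) (f : {ffun P -> Q}) : bool :=
  [&& injectiveb f,
      [forall x, forall y, prec x y == prec (f x) (f y)]
    & [forall x, forall y, lin x y == lin (f x) (f y)]].

Lemma embeddingP (P Q : ordPoset) (f : {ffun P -> Q}) :
  reflect [/\ injective f,
              forall x y, prec x y = prec (f x) (f y)
            & forall x y, lin x y = lin (f x) (f y)]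
          (embedding f).
Proof.
apply: (iffP and3P) => -[f_inj fR fL]; split.
- exact/injectiveP.
- by move=> x y; apply/eqP; move/forallP/(_ x)/forallP/(_ y): fR.
- by move=> x y; apply/eqP; move/forallP/(_ x)/forallP/(_ y): fL.
- exact/injectiveP.
- by apply/forallP=> x; apply/forallP=> y; rewrite fR.
- by apply/forallP=> x; apply/forallP=> y; rewrite fL.
Qed.

Definition sub_prec (S : ordPoset) (B : {set S}) : rel {x : S | x \in B} :=
  fun x y => prec (val x) (val y).

Definition sub_lin (S : ordPoset) (B : {set S}) : rel {x : S | x \in B} :=
  fun x y => lin (val x) (val y).

Fact sub_prec_irr (S : ordPoset) (B : {set S}) : irreflexive (@sub_prec S B).
Proof. by move=> x; apply: prec_irr. Qed.

Fact sub_prec_trans (S : ordPoset) (B : {set S}) : transitive (@sub_prec S B).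
Proof. by move=> y x z; apply: prec_trans. Qed.

Fact sub_lin_refl (S : ordPoset) (B : {set S}) : reflexive (@sub_lin S B).
Proof. by move=> x; apply: lin_refl. Qed.

Fact sub_lin_anti (S : ordPoset) (B : {set S}) : antisymmetric (@sub_lin S B).
Proof. by move=> x y /lin_anti/val_inj. Qed.

Fact sub_lin_trans (S : ordPoset) (B : {set S}) : transitive (@sub_lin S B).
Proof. by move=> y x z; apply: lin_trans. Qed.

Fact sub_lin_total (S : ordPoset) (B : {set S}) : total (@sub_lin S B).
Proof. by move=> x y; apply: lin_total. Qed.

Fact sub_prec_lin (S : ordPoset) (B : {set S}) :
  subrel (@sub_prec S B) (@sub_lin S B).
Proof. by move=> x y; apply: prec_lin. Qed.

Definition subposet (S : ordPoset) (B : {set S}) : ordPoset :=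
  @OrdPoset {x : S | x \in B} _ _
    (@sub_prec_irr S B) (@sub_prec_trans S B) (@sub_lin_refl S B)
    (@sub_lin_anti S B) (@sub_lin_trans S B) (@sub_lin_total S B)
    (@sub_prec_lin S B).

(* Both relations of an ordered subposet of Q are restricted from Q, so a
   subobject of Q is represented by its vertex set. *)
Definition copies (Q P : ordPoset) : {set {set Q}} :=
  [set [set f x | x : P] | f : {ffun P -> Q} & embedding f].

Definition binom (Q P : ordPoset) : finType := {A : {set Q} | A \in copies Q P}.

Fact lift_copy_subproof (S P : ordPoset) (B : {set S})
    (A : binom (subposet B) P) :
  [set val x | x in val A] \in copies S P.
Proof.
case: A => A /= /imsetP[f]; rewrite inE => /embeddingP[f_inj fR fL] ->.
apply/imsetP; exists [ffun x => val (f x)].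
  rewrite inE; apply/embeddingP; split=> x y; rewrite !ffunE.
  - by move/val_inj/f_inj.
  - by rewrite fR.
  - by rewrite fL.
rewrite -imset_comp; apply: eq_imset => x; by rewrite ffunE.
Qed.

(* A copy of P in a subposet of S, regarded as a copy of P in S. *)
Definition lift_copy (S P : ordPoset) (B : {set S})
    (A : binom (subposet B) P) : binom S P :=
  exist _ [set val x | x in val A] (lift_copy_subproof A).

Definition arrows (S Q P : ordPoset) (r : nat) : Prop :=
  forall chi : binom S P -> 'I_r,
    exists B : binom S Q,
      forall A1 A2 : binom (subposet (val B)) P,
        chi (lift_copy A1) = chi (lift_copy A2).

Definition ramsey_class (C : ordPoset -> Prop) : Prop :=
  forall P Q : ordPoset, C P -> C Q ->
  forall r : nat, 0 < r -> exists2 S : ordPoset, C S & arrows S Q P r.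

Definition all_ordPosets : ordPoset -> Prop := fun=> True.

(* Main.v *)
Require Import Defs.
From mathcomp Require Import all_boot zify.

Set Implicit Arguments.
Unset Strict Implicit.
Unset Printing Implicit Defensive.

(** The Ramsey poset is a cube: all subsets of [{0, ..., N-1}], ordered by
    strict inclusion, with the linear extension comparing two sets by the owner
    of the least element of their symmetric difference.

    A map [f] from an ordered poset [P] to the cube is determined by the word of
    length [N] whose [i]-th letter is [{x | i \in f x}], and if [f] is monotone
    every letter is an up-set of [P].  Conversely, list the up-sets of [P] in
    the linear order of the cube on [P], so that the empty set comes first.  A
    word in which every nonempty up-set occurs, the first occurrences being in
    the order of the list, yields an embedding ([word_map_embedding]): the
    principal up-sets make it reflect the partial order, and if [x] precedes [y]
    in the linear order then the first letter separating [x] from [y] is the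
    up-set generated by [y], so that the image of [x] precedes that of [y].

    Such words are the parameter words of Graham and Rothschild, with the empty
    up-set as the only constant and the nonempty up-sets as parameters.  Taking
    preimages of up-sets turns an embedding of [P] into [Q] into a parameter
    word ([param_word_pullback]); here the order on up-sets is essential.
    Substituting it into a word over the up-sets of [Q] corresponds to composing
    with the embedding ([word_map_pullback]).  So the Graham-Rothschild theorem,
    applied to the colouring that gives a word the colour of the copy of [P] it
    describes, yields a word for [Q], and the copy of [Q] it describes contains
    only copies of [P] of one colour.

    The Graham-Rothschild theorem is proved by induction on the number of
    parameters, over all alphabets at once.  Once the first parameter has
    occurred in a word it behaves like one more constant, so the theorem with
    one parameter fewer makes the colour depend only on the constants before the
    first parameter ([colour_by_prefix]).  Repeated use of the Hales-Jewett
    theorem then removes the dependence on this prefix ([mono_prefixes]). *)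

(** * Combinatorial lines and the Hales-Jewett theorem *)

Definition fill (x : nat) (u : seq (option nat)) : seq nat := map (odflt x) u.

(** [None] marks the active coordinates of a combinatorial line.  With this
    encoding a line over [a] letters is literally a line over more letters. *)
Definition line (a N : nat) (u : seq (option nat)) : Prop :=
  [/\ size u = N, None \in u & all (oapp (fun l => l < a) true) u].

Lemma fill_cat x u v : fill x (u ++ v) = fill x u ++ fill x v.
Proof. exact: map_cat. Qed.

Lemma fill_Some x w : fill x (map some w) = w.
Proof. by rewrite /fill -map_comp map_id. Qed.

Lemma size_fill x u : size (fill x u) = size u.
Proof. exact: size_map. Qed.

Lemma all_some a w :
  all (oapp (fun l => l < a) true) (map some w) = all (fun l => l < a) w.
Proof. by rewrite all_map. Qed.

Lemma all_fill b x u : x < b -> all (oapp (fun l => l < b) true) u ->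
  all (fun l => l < b) (fill x u).
Proof. by move=> xb; rewrite /fill all_map; apply: sub_all; case. Qed.

Lemma all_lettersW a b u : a <= b ->
  all (oapp (fun l => l < a) true) u -> all (oapp (fun l => l < b) true) u.
Proof. by move=> ab; apply: sub_all => -[l|//] /= la; exact: leq_trans la ab. Qed.

(** Bounded words over a finite alphabet form a finite type, so a family of
    colours indexed by them is again a colour from a finite set. *)
Lemma word_bseq b M (w : seq nat) : size w <= M -> all (fun l => l < b) w ->
  exists y : {bseq M of 'I_b}, w = map val y.
Proof.
move=> sw wb.
have sp : size (pmap insub w : seq 'I_b) <= M.
  by rewrite size_pmap_sub (leq_trans _ sw) ?count_size.
exists (Bseq sp) => /=; rewrite pmap_filter; last exact: insubK.
rewrite -[LHS]filter_predT; apply/eq_in_filter => x xw.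
by rewrite /= isSome_insub; apply/esym; move/allP: wb; apply.
Qed.

Definition has_mono_line (a N : nat) (K : finType) (c : seq nat -> K) : Prop :=
  exists u, line a N u /\ forall x, x < a -> c (fill x u) = c (fill 0 u).

Definition hales_jewett_at (a : nat) : Prop :=
  forall K : finType, exists N, forall c : seq nat -> K, has_mono_line a N c.

(** Colouring a block by the function sending each context to the colour of the
    block in that context gives one line that is monochromatic in every context
    simultaneously. *)
Lemma line_colour_contexts a b M (K : finType) : hales_jewett_at a ->
  exists H, forall c : seq nat -> seq nat -> K, exists u, line a H u /\
    forall x w, x < a -> size w <= M -> all (fun l => l < b) w ->
      c (fill x u) w = c (fill 0 u) w.
Proof.
move=> /(_ {ffun {bseq M of 'I_b} -> K})[H hH]; exists H => c.
have [u [lu cu]] := hH (fun p => [ffun y : {bseq M of 'I_b} => c p (map val y)]).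
exists u; split=> // x w xa sw /(word_bseq sw)[y ->].
by have /ffunP/(_ y) := cu x xa; rewrite !ffunE.
Qed.

(** Either there is a monochromatic line, or there are [s] lines with the same
    end point [p] that are monochromatic, in [s] different colours, off that
    point.  In the inductive step a line [l] is found on a new block so that the
    colour does not depend on the position along [l], its end point excepted.
    The old lines then extend diagonally along [l], and [l] followed by the
    constant [p] is one more focused line; if its colour is not new, it is the
    colour of a line through [p] that becomes monochromatic altogether. *)
Lemma colour_focusing a (K : finType) s : 0 < a -> hales_jewett_at a ->
  exists N, forall c : seq nat -> K, has_mono_line a.+1 N c \/
    exists p (L : {set K}), [/\ #|L| = s, size p = N, all (fun l => l < a.+1) p
      & forall i, i \in L -> exists u, [/\ line a.+1 N u, fill a u = p
          & forall x, x < a -> c (fill x u) = i]].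
Proof.
move=> a0 hj; elim: s => [|s [N IH]].
  exists 0 => c; right; exists [::], set0; rewrite cards0; split=> // i.
  by rewrite inE.
have [H hH] := line_colour_contexts a.+1 N K hj.
exists (H + N) => c.
have [l [[sl nl al] cl]] := hH (fun b w => c (b ++ w)).
have al' := all_lettersW (leqnSn a) al.
have line_after (q : seq nat) u : size q = H -> all (fun l => l < a.+1) q ->
    line a.+1 N u -> line a.+1 (H + N) (map some q ++ u).
  move=> sq aq [su nu au]; split; first by rewrite size_cat size_map sq su.
    by rewrite mem_cat nu orbT.
  by rewrite all_cat all_some aq.
have a0l : all (fun l => l < a.+1) (fill 0 l) by apply: all_fill.
have s0l : size (fill 0 l) = H by rewrite size_fill.
have [[u [lu cu]]|[p [L [sL sp ap fL]]]] := IH (fun w => c (fill 0 l ++ w)).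
  left; exists (map some (fill 0 l) ++ u); split; first exact: line_after.
  by move=> x xa; rewrite !fill_cat !fill_Some; apply: cu.
pose j := c (fill 0 l ++ p).
have [jL|jL] := boolP (j \in L).
  left; have [u [lu up cu]] := fL j jL.
  exists (map some (fill 0 l) ++ u); split; first exact: line_after.
  move=> x; rewrite ltnS leq_eqVlt !fill_cat !fill_Some => /orP[/eqP->|xa].
    by rewrite up cu.
  by rewrite !cu.
right; exists (fill a l ++ p), (j |: L).
split; first by rewrite cardsU1 jL sL.
- by rewrite size_cat size_fill sl sp.
- by rewrite all_cat all_fill.
move=> i /setU1P[->|iL].
  exists (l ++ map some p); split.
  - split; first by rewrite size_cat size_map sl sp.
      by rewrite mem_cat nl.
    by rewrite all_cat al' all_some.
  - by rewrite fill_cat fill_Some.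
  - by move=> x xa; rewrite fill_cat fill_Some cl ?sp.
have [u [[su nu au] up cu]] := fL i iL.
exists (l ++ u); split.
- split; first by rewrite size_cat sl su.
    by rewrite mem_cat nl.
  by rewrite all_cat al'.
- by rewrite fill_cat up.
- move=> x xa; rewrite fill_cat cl ?size_fill ?su ?cu //.
  by apply: all_fill => //; apply: leq_trans xa _.
Qed.

(** Focusing more lines than there are colours is impossible. *)
Theorem hales_jewett a : 0 < a -> hales_jewett_at a.
Proof.
case: a => // a _; elim: a => [|a IH] K.
  by exists 1 => c; exists [:: None]; split=> // -[].
have [N hN] := colour_focusing K #|K|.+1 (ltn0Sn a) IH.
exists N => c; have [//|[p [L [sL _ _ _]]]] := hN c.
by have := max_card (mem L); rewrite sL ltnn.
Qed.

(** * Parameter words *)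

(** Letters below [a] are constants and the letters [a, ..., b-1] are the
    parameters, each of which has to occur, in order of first occurrence.  In
    the recursion a parameter that has occurred becomes a constant: this is what
    lets the number of parameters be traded for the size of the alphabet. *)
Fixpoint param_word (a b : nat) (w : seq nat) : bool :=
  if w is l :: w' then
    if l < a then param_word a b w' else (l == a) && param_word a.+1 b w'
  else a == b.

(** Composition of parameter words: constants are kept and the [j]-th parameter
    is replaced by the [j]-th letter of [v]. *)
Definition subst (a : nat) (v u : seq nat) : seq nat :=
  map (nth 0 (iota 0 a ++ v)) u.

Lemma param_wordP a b w :
  reflect [/\ a <= b, forall l, l \in w -> l < b,
              forall l, a <= l -> l < b -> l \in w
            & forall i l, i < size w -> a <= l -> l < nth 0 w i ->
                l \in take i w]
          (param_word a b w).
Proof.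
elim: w a => [|x w IH] a /=.
  apply: (iffP eqP) => [->|[ab _ h _]]; first by split=> // l; lia.
  by have [//|lab] := eqVneq a b; have := h a (leqnn a); rewrite in_nil; lia.
have [xa|ax] := ltnP x a.
  apply: (iffP (IH a)) => -[ab wb bw first_occ]; split=> //.
  - by move=> l; rewrite inE => /predU1P[->|/wb//]; lia.
  - by move=> l al lb; rewrite inE bw ?orbT.
  - case=> [|i] l /= iw al lx; first by lia.
    by rewrite inE (first_occ i) ?orbT.
  - by move=> l lw; apply: wb; rewrite inE lw orbT.
  - by move=> l al lb; have := bw l al lb; rewrite inE => /predU1P[|//]; lia.
  - move=> i l iw al lx; have := first_occ i.+1 l iw al lx.
    by rewrite /= inE => /predU1P[|//]; lia.
apply: (iffP andP) => [[/eqP-> /IH[ab wb bw first_occ]]|[ab wb bw first_occ]].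
  split=> [|l|l al lb|[|i] l /= iw al lx].
  - exact: ltnW.
  - by rewrite inE => /predU1P[->|/wb].
  - by rewrite inE; have [//|la] := eqVneq l a; apply: bw => //; lia.
  - by lia.
  - by rewrite inE; have [//|la] := eqVneq l a; apply: first_occ => //; lia.
have {ax}xa : x = a.
  by have := first_occ 0 a erefl (leqnn a); rewrite /= in_nil; lia.
rewrite xa eqxx; split=> //; apply/IH; split=> [|l lw|l al lb|i l iw al lx].
- by rewrite -xa wb ?mem_head.
- by apply: wb; rewrite inE lw orbT.
- by have := bw l (ltnW al) lb; rewrite inE => /predU1P[|//]; lia.
- have := first_occ i.+1 l iw (ltnW al) lx.
  by rewrite /= inE => /predU1P[|//]; lia.
Qed.

Lemma param_word_leq a b w : param_word a b w -> a <= b.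
Proof. by case/param_wordP. Qed.

Lemma param_word_lt a b w : param_word a b w -> all (fun l => l < b) w.
Proof. by case/param_wordP => _ h _ _; apply/allP. Qed.

Lemma param_word_const a w : param_word a a w = all (fun l => l < a) w.
Proof.
apply/idP/allP => [/param_word_lt/allP//|h]; apply/param_wordP; split=> //.
  by move=> l al la; lia.
by move=> i l iw al li; have /= := h _ (mem_nth 0 iw); lia.
Qed.

Lemma param_word_cat a b c u v :
  param_word a b u -> param_word b c v -> param_word a c (u ++ v).
Proof.
elim: u a => [|x u IH] a /=; first by move/eqP->.
by case: ifP => [_ /IH//|_ /andP[-> /IH]].
Qed.

(** In a substitution into a suffix of a parameter word, the values [e1] of all
    letters already seen are constants; this form carries the induction behind
    [param_word_subst]. *)
Lemma param_word_nth e1 v a' b' a b u : all (fun l => l < a) e1 ->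
  size e1 = a' -> size (e1 ++ v) = b' -> param_word a' b' u ->
  param_word a b v -> param_word a b (map (nth 0 (e1 ++ v)) u).
Proof.
elim: u e1 v a' a => [|l u IH] e1 v a' a e1a s1 s2 /=.
  by move/eqP=> ab; move: s2; rewrite size_cat s1 ab; case: v => //=; lia.
case: ifP => [la' hu hv|la' /andP[/eqP ela' hu] hv].
  rewrite nth_cat s1 la'.
  by have /allP/(_ _ (mem_nth 0 _)) -> := e1a; rewrite ?s1 //; apply: IH hu _.
case: v hv s2 => [|x v] hv s2.
  by move: (param_word_leq hu) s2; rewrite cats0; lia.
rewrite nth_cat s1 la' ela' subnn /=.
move: hv; rewrite /= -cat_rcons; move: s2; rewrite -cat_rcons => s2.
have sr : size (rcons e1 x) = a'.+1 by rewrite size_rcons s1.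
case: ifP => [xa hv|xa /andP[xa' hv]].
  by apply: IH hu hv => //; rewrite all_rcons xa.
rewrite xa'; apply: IH hu hv => //; rewrite all_rcons (eqP xa') ltnSn.
by apply: sub_all e1a => y; apply: leqW.
Qed.

Lemma param_word_subst a b' b u v : param_word a b' u -> size v = b' - a ->
  param_word a b v -> param_word a b (subst a v u).
Proof.
move=> hu sv hv; have ab' := param_word_leq hu.
apply: param_word_nth hu hv; rewrite ?size_cat ?size_iota ?sv //.
  by apply/allP => x; rewrite mem_iota.
by lia.
Qed.

Lemma size_subst a v u : size (subst a v u) = size u.
Proof. exact: size_map. Qed.

Lemma subst_cat a v u1 u2 : subst a v (u1 ++ u2) = subst a v u1 ++ subst a v u2.
Proof. exact: map_cat. Qed.

Lemma nth_ext_lt a v l : l < a -> nth 0 (iota 0 a ++ v) l = l.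
Proof. by move=> la; rewrite nth_cat size_iota la nth_iota. Qed.

Lemma subst_const a v u : all (fun l => l < a) u -> subst a v u = u.
Proof.
move=> /allP ua; rewrite -[RHS]map_id; apply/eq_in_map => l lu.
exact/nth_ext_lt/ua.
Qed.

Lemma subst_subst a v t u : all (fun l => l < a + size t) u ->
  subst a v (subst a t u) = subst a (subst a v t) u.
Proof.
move=> /allP ua; rewrite /subst -map_comp; apply/eq_in_map => l /ua la /=.
have [al|al] := ltnP l a; first by rewrite !nth_ext_lt.
rewrite ![nth _ (_ ++ _) l]nth_cat size_iota ltnNge al /=.
by rewrite (nth_map 0) ?nth_cat ?size_iota //; lia.
Qed.

Lemma iota_ext a v : iota 0 a.+1 ++ v = iota 0 a ++ a :: v.
Proof. by rewrite -[in LHS]addn1 iotaD -catA. Qed.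

Lemma substS a v u : subst a.+1 v u = subst a (a :: v) u.
Proof. by rewrite /subst iota_ext. Qed.

(** [bump a] renames the parameters of [t] to make room for a new first one. *)
Lemma subst_bump a x v t : subst a (x :: v) (map (bump a) t) = subst a v t.
Proof.
rewrite /subst -map_comp; apply: eq_map => l /=.
have [al|al] := ltnP l a; rewrite /bump.
  by rewrite leqNgt al !nth_ext_lt.
by rewrite al !nth_cat size_iota add1n ltnNge leqW //= ltnNge al subSn.
Qed.

Lemma param_word_bump a a' b t : a <= a' ->
  param_word a' b t -> param_word a'.+1 b.+1 (map (bump a) t).
Proof.
elim: t a' => [|x t IH] a' aa' //=.
case: ifP => xa'; last first.
  case/andP => /eqP-> ht; rewrite /bump aa' add1n ltnn eqxx.
  by apply: IH => //; apply: leqW.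
by move/(IH _ aa') ->; rewrite ifT // /bump; lia.
Qed.

Lemma subst_fill a x v l : all (oapp (fun m => m < a) true) l ->
  subst a (x :: v) (fill a l) = fill x l.
Proof.
move=> /allP la; rewrite /subst /fill -map_comp; apply/eq_in_map => -[m /la|_] /=.
  exact: nth_ext_lt.
by rewrite nth_cat size_iota ltnn subnn.
Qed.

Lemma param_word_fill a b H l : a <= b -> line a H l ->
  param_word b b.+1 (fill b l).
Proof.
move=> ab [_ nl /allP la]; apply/param_wordP; split=> //.
- by move=> m /mapP[[k|] kl -> /=] //; have := la _ kl; rewrite /=; lia.
- move=> m bm mb; apply/mapP; exists None => //=; lia.
move=> i m; rewrite size_fill => il bm.
rewrite (nth_map None) //.
by case E : (nth None l i) (la _ (mem_nth None il)) => [k|] /=; lia.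
Qed.

(** * The Graham-Rothschild theorem *)

Definition graham_rothschild_at (a k : nat) : Prop :=
  forall (K : finType) n, exists N, forall c : seq nat -> K,
    exists u i, [/\ size u = N, param_word a (a + n) u
      & forall v, size v = n -> param_word a (a + k) v -> c (subst a v u) = i].

(** Without parameters to colour, the statement is the multidimensional
    Hales-Jewett theorem: one line is appended for every dimension, chosen to
    be monochromatic in all contexts given by the earlier blocks. *)
Lemma hales_jewett_multidim a : 0 < a -> graham_rothschild_at a 0.
Proof.
move=> a0 K; elim=> [|n [N hN]].
  exists 0 => c; exists [::], (c [::]); split=> //=; first by rewrite addn0.
have [H hH] := line_colour_contexts a N K (hales_jewett a0).
exists (N + H) => c.
have [l [ll cl]] := hH (fun b w => c (w ++ b)).
have [u [i [su pu cu]]] := hN (fun w => c (w ++ fill 0 l)).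
exists (u ++ fill (a + n) l), i; have [sl nl al] := ll; split.
- by rewrite size_cat size_fill su sl.
- by rewrite addnS; apply: param_word_cat pu _; apply: param_word_fill ll; lia.
case/lastP => [//|v x]; rewrite size_rcons addn0 param_word_const all_rcons.
move=> [sv] /andP[xa va].
have -> : subst a (rcons v x) (u ++ fill (a + n) l) = subst a v u ++ fill x l.
  rewrite subst_cat; congr (_ ++ _).
    apply/eq_in_map => m mu; have := allP (param_word_lt pu) m mu => man.
    rewrite -rcons_cat nth_rcons size_cat size_iota sv ifT //.
  rewrite /subst /fill -map_comp; apply/eq_in_map => -[m ml|_] /=.
    exact/nth_ext_lt/(allP al _ ml).
  by rewrite -rcons_cat nth_rcons size_cat size_iota sv ltnn eqxx.
have pv : param_word a (a + 0) v by rewrite addn0 param_word_const.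
rewrite cl ?size_subst ?su // ?cu //.
rewrite -param_word_const; apply: param_word_subst pu _ _; first by lia.
by rewrite param_word_const.
Qed.

Definition before (a : nat) (w : seq nat) : seq nat := take (index a w) w.

(** Words whose first letter is the first parameter [a] are words with one
    parameter fewer over the alphabet enlarged by [a], so the hypothesis gives
    [u] with all of them of one colour [j] below [a :: u].  For words starting
    with a constant [x] the induction on [m] applies to the rest of the word,
    with the family of the colours for all [x] as its colour. *)
Lemma colour_by_prefix a k m : graham_rothschild_at a.+1 k ->
  forall K : finType, exists N, forall c : seq nat -> K,
    exists u (d : seq nat -> K), [/\ size u = N, param_word a (a + m) u
      & forall v, size v = m -> param_word a (a + k.+1) v ->
          c (subst a v u) = d (before a v)].
Proof.
move=> gr; elim: m => [|m IH] K.
  exists 0 => c; exists [::], (fun=> c [::]); split=> //=.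
  by rewrite addn0.
have [M hM] := IH {ffun 'I_a -> K}.
have [N hN] := gr K M.
exists N.+1 => c.
have [u [j [su pu cu]]] := hN (fun w => c (a :: w)).
have [t [d [st pt ct]]] := hM (fun v => [ffun x : 'I_a => c (subst a (val x :: v) (a :: u))]).
have pau : param_word a (a.+1 + M) (a :: u) by rewrite /= ltnn eqxx.
have pat : param_word a (a + m.+1) (a :: map (bump a) t).
  by rewrite /= ltnn eqxx addnS; apply: param_word_bump pt.
exists (subst a (a :: map (bump a) t) (a :: u)).
exists (fun p => if p is x :: p' then
  if insub x is Some y then d p' y else j else j).
split; first by rewrite size_subst /= su.
  by apply: param_word_subst pau _ pat; rewrite /= size_map st; lia.
case=> [//|x v] [sv] pv.
rewrite subst_subst; last first.
  by rewrite [size _]/= size_map st addnS -addSn (param_word_lt pau).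
have -> : subst a (x :: v) (a :: map (bump a) t) = x :: subst a v t.
  by rewrite /= subst_bump nth_cat size_iota ltnn subnn.
move: pv => /=; case: ifP => [xa pv|xa /andP[/eqP {xa}-> pv]].
  rewrite /before /= ifF; last by apply/eqP; lia.
  rewrite /= insubT /= -/(before a v) -ct //.
  by rewrite ffunE.
rewrite /before /= eqxx /= nth_cat size_iota ltnn subnn /=.
rewrite -/(subst a (a :: subst a v t) u) -substS cu ?size_subst //; last first.
  have pt' := param_word_bump (leqnn a) pt.
  have -> : subst a v t = subst a.+1 v (map (bump a) t).
    by rewrite substS subst_bump.
  rewrite addSn -addnS; apply: param_word_subst pt' _ pv; rewrite sv; lia.
Qed.

Lemma beforeE a u v : a \notin u -> before a (u ++ v) = u ++ before a v.
Proof.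
move=> au; rewrite /before index_cat (negPf au) take_cat ltnNge leq_addr /=.
by rewrite addKn.
Qed.

Lemma before_cat a u v : a \in u -> before a (u ++ v) = before a u.
Proof.
by move=> au; rewrite /before index_cat au take_cat index_mem au.
Qed.

(** As in Ramsey's theorem, a separate number [f i] of dimensions is demanded
    for each colour [i] and the induction is on their sum.  Take a block with a
    line [l] such that, whatever follows the block, the colour is the same for
    all constants put on [l], and let [j] be the colour of the constants before
    the first active coordinate of [l].  After this block the induction
    hypothesis, with the demand for [j] lowered by one, provides the word [t].
    If its colour is [j], then [l] becomes a new first parameter; otherwise the
    block is filled with a constant. *)
Lemma mono_prefixes a k (K : finType) (f : K -> nat) : 0 < a ->
  exists M, forall d : seq nat -> K,
    exists i s, [/\ size s <= M, param_word a (a + f i) s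
      & forall v, size v = f i -> param_word a (a + k.+1) v ->
          d (before a (subst a v s)) = i].
Proof.
move=> a0; have [S leS] := ubnP (\sum_i f i); elim: S f leS => // S IH f leS.
have [/existsP[i /eqP fi]|nf] := boolP [exists i, f i == 0].
  exists 0 => d; exists i, [::]; split=> //=; first by rewrite fi addn0.
  by move=> v; rewrite fi => /size0nil-> /=; lia.
have fpos i : 0 < f i by rewrite lt0n; apply: contra nf => fi; apply/existsP; exists i.
pose dec j i := if i == j then (f i).-1 else f i.
have [Mj hM] : exists Mj : K -> nat, forall j, forall d : seq nat -> K,
    exists i s, [/\ size s <= Mj j, param_word a (a + dec j i) s
      & forall v, size v = dec j i -> param_word a (a + k.+1) v ->
          d (before a (subst a v s)) = i].
  apply: (@fin_all_exists _ (fun=> nat) (fun j Nj => forall d : seq nat -> K,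
    exists i s, [/\ size s <= Nj, param_word a (a + dec j i) s
      & forall v, size v = dec j i -> param_word a (a + k.+1) v ->
          d (before a (subst a v s)) = i])) => j; apply: IH.
  rewrite -ltnS; apply: leq_trans leS; rewrite ltnS.
  rewrite [X in _ < X](bigD1 j) //= (bigD1 j) //= {1}/dec eqxx.
  have -> : \sum_(i | i != j) dec j i = \sum_(i | i != j) f i.
    by apply: eq_bigr => i /negPf ij; rewrite /dec ij.
  by have := fpos j; lia.
pose M := \max_j Mj j.
have [H hH] := line_colour_contexts a M K (hales_jewett a0).
exists (H + M) => d.
have [l [ll cl]] := hH (fun b w => d (b ++ w)); have [sl nl al] := ll.
have nfill x : x < a -> a \notin fill x l.
  move=> xa; apply/negP => /mapP[[m|] /(allP al) /=]; last by lia.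
  by move=> ma; lia.
pose j := d (before a (fill a l)).
have [i [t [st pt ct]]] := hM j (fun y => d (fill 0 l ++ y)).
have stM : size t <= M by apply: leq_trans st (leq_bigmax j).
have [ij|ij] := eqVneq i j; last first.
  exists i, (fill 0 l ++ t); move: pt ct; rewrite /dec (negPf ij) => pt ct.
  have a0l : all (fun m => m < a) (fill 0 l) by apply: all_fill.
  split; first by rewrite size_cat size_fill sl leq_add2l.
    by apply: param_word_cat pt; rewrite param_word_const.
  by move=> v sv pv; rewrite subst_cat (subst_const _ a0l) beforeE ?nfill ?ct.
exists j, (fill a l ++ map (bump a) t).
move: pt ct; rewrite /dec ij eqxx => pt ct.
have fj := fpos j.
split; first by rewrite size_cat size_fill size_map sl leq_add2l.
  apply: param_word_cat (param_word_fill (leqnn a) ll) _.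
  by rewrite -[f j]prednK // addnS; apply: param_word_bump pt.
case=> [|x v] sv pv; first by move: sv fj => /= <-.
rewrite subst_cat subst_fill // subst_bump.
move: pv => /=; case: ifP => [xa pv|xa /andP[/eqP -> pv]]; last first.
  by rewrite before_cat //; apply/mapP; exists None.
rewrite beforeE ?nfill // cl //; first by rewrite ct // -sv.
  by rewrite (leq_trans _ stM) // -(size_subst a v t) size_take; case: ltnP => // /ltnW.
have /param_wordP[_ _ _ first_occ] : param_word a (a + k.+1) (subst a v t).
  by apply: param_word_subst pt _ pv; move: sv => /=; lia.
apply/allP => m; rewrite /before; set w := subst a v t in first_occ *.
case/(nthP 0) => q; rewrite size_takel ?index_size // => qi <-.
rewrite nth_take //.
have qw : q < size w by apply: leq_trans qi (index_size _ _).
have := first_occ q a qw (leqnn a).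
have := before_find 0 qi; rewrite /= => /negbT; rewrite /= => nqa h.
rewrite ltn_neqAle nqa leqNgt; apply/negP => /h /index_ltn; lia.
Qed.

Theorem graham_rothschild a k : 0 < a -> graham_rothschild_at a k.
Proof.
elim: k a => [|k IH] a a0; first exact: hales_jewett_multidim.
move=> K n.
have [M hM] := mono_prefixes k (fun _ : K => n) a0.
have [N hN] := colour_by_prefix M (IH a.+1 (ltn0Sn a)) K.
exists N => c.
have [u [d [su pu cu]]] := hN c.
have [i [s [ss ps ds]]] := hM d.
(* [s] may be shorter than [M]; padding with the constant [0] does not affect
   what comes before the first parameter. *)
pose s' := s ++ nseq (M - size s) 0.
have z : all (fun l => l < a) (nseq (M - size s) 0) by rewrite all_nseq a0 orbT.
have z' v : subst a v s' = subst a v s ++ nseq (M - size s) 0.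
  by rewrite subst_cat (subst_const _ z).
have ss' : size s' = M by rewrite size_cat size_nseq subnKC.
have ps' : param_word a (a + n) s'.
  apply: param_word_cat ps _; rewrite param_word_const.
  by apply: sub_all z => l; lia.
exists (subst a s' u), i; split; first by rewrite size_subst.
  by apply: param_word_subst pu _ ps'; rewrite ss'; lia.
move=> v sv pv; rewrite subst_subst ?ss' ?(param_word_lt pu) //.
have pvs : param_word a (a + k.+1) (subst a v s).
  by apply: param_word_subst ps _ pv; lia.
rewrite cu ?size_subst //; last first.
  by apply: param_word_subst ps' _ pv; lia.
rewrite z' before_cat ?ds //.
by case/param_wordP: pvs => _ _ h _; apply: h; lia.
Qed.

(** * Cubes as ordered posets *)

Definition set_lt (T : ordPoset) (X Y : {set T}) : bool :=
  [exists m, [&& m \in Y, m \notin X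
    & [forall z, (z != m) && lin z m ==> ((z \in X) == (z \in Y))]]].

Definition set_le (T : ordPoset) : rel {set T} := fun X Y => (X == Y) || set_lt X Y.

Lemma set_ltP (T : ordPoset) (X Y : {set T}) :
  reflect (exists m, [/\ m \in Y, m \notin X
             & forall z, z != m -> lin z m -> (z \in X) = (z \in Y)])
          (set_lt X Y).
Proof.
apply: (iffP existsP) => -[m].
  case/and3P=> mY mX /forallP agree; exists m; split=> // z zm lzm.
  by apply/eqP; move/implyP: (agree z); rewrite zm lzm; apply.
case=> mY mX agree; exists m; rewrite mY mX; apply/forallP => z.
by apply/implyP => /andP[zm lzm]; rewrite agree.
Qed.

Lemma set_lt_irr (T : ordPoset) : irreflexive (@set_lt T).
Proof. by move=> X; apply/set_ltP => -[m [-> ]]. Qed.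

Lemma set_lt_trans (T : ordPoset) : transitive (@set_lt T).
Proof.
move=> Y X Z /set_ltP[m [mY mX XY]] /set_ltP[n [nZ nY YZ]].
have mn : m != n by apply: contraTneq mY => ->.
have [lmn|lnm] := orP (lin_total m n).
  apply/set_ltP; exists m; split=> // [|z zm lzm]; first by rewrite -YZ.
  rewrite XY // YZ ?(lin_trans lzm lmn) //.
  by apply: contra_neq zm => zn; apply: lin_anti; rewrite lzm zn lmn.
apply/set_ltP; exists n; rewrite eq_sym in mn.
split=> // [|z zn lzn]; first by rewrite XY.
rewrite XY ?YZ ?(lin_trans lzn lnm) //.
by apply: contra_neq zn => zm; apply: lin_anti; rewrite lzn zm lnm.
Qed.

Lemma set_lt_neq (T : ordPoset) (X Y : {set T}) :
  X != Y -> set_lt X Y || set_lt Y X.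
Proof.
move=> XY.
have [z0 z0D] : exists z, (z \in X) != (z \in Y).
  apply/existsP; apply: contraR XY; rewrite negb_exists => /forallP XY.
  by apply/eqP/setP => z; apply/eqP; rewrite -[_ == _]negbK.
have [m mD minm] := @extremumP _ _ _ z0 (fun z => (z \in X) != (z \in Y)) id
  (@lin_refl T) (@lin_trans T) (@lin_total T) z0D.
have agree z : z != m -> lin z m -> (z \in X) = (z \in Y).
  move=> zm lzm; apply/eqP; apply: contraR zm => /minm lmz.
  by apply/eqP/lin_anti; rewrite lzm lmz.
apply/orP; have [mX|mX] := boolP (m \in X); [right|left]; apply/set_ltP; exists m.
  split=> // [|z zm lzm]; first by rewrite mX in mD; case: (m \in Y) mD.
  by rewrite agree.
by split=> //; move: mD; rewrite (negPf mX); case: (m \in Y).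
Qed.

Lemma set_lt_proper (T : ordPoset) (X Y : {set T}) : X \proper Y -> set_lt X Y.
Proof.
rewrite properEneq => /andP[XY sXY].
have [//|/set_ltP[m [mX mY _]]] := orP (set_lt_neq XY).
by rewrite (subsetP sXY) in mY.
Qed.

(** The linear order of a cube depends only on the linear order of [T].  Besides
    the Ramsey poset it is used for ordering the up-sets of a poset. *)
Section Cube.
Context (T : ordPoset).

Fact proper_irr : irreflexive (fun X Y : {set T} => X \proper Y).
Proof. exact: properxx. Qed.

Fact proper_transitive : transitive (fun X Y : {set T} => X \proper Y).
Proof. by move=> Y X Z; apply: proper_trans. Qed.

Fact set_le_refl : reflexive (@set_le T).
Proof. by move=> X; rewrite /set_le eqxx. Qed.

Fact set_le_anti : antisymmetric (@set_le T).
Proof.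
move=> X Y /andP[/predU1P[//|XY] /predU1P[//|YX]].
by have := set_lt_trans XY YX; rewrite set_lt_irr.
Qed.

Fact set_le_trans : transitive (@set_le T).
Proof.
move=> Y X Z /predU1P[->//|XY] /predU1P[<-|YZ]; apply/predU1P; right=> //.
exact: set_lt_trans XY YZ.
Qed.

Fact set_le_total : total (@set_le T).
Proof.
move=> X Y; rewrite /set_le; have [//|XY] := eqVneq X Y.
exact: set_lt_neq.
Qed.

Fact proper_set_le : subrel (fun X Y : {set T} => X \proper Y) (@set_le T).
Proof. by move=> X Y XY; rewrite /set_le set_lt_proper ?orbT. Qed.

Definition cube : ordPoset :=
  OrdPoset proper_irr proper_transitive set_le_refl set_le_anti set_le_trans
    set_le_total proper_set_le.

End Cube.

Section Antichain.
Context (N : nat).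

Fact ord_leq_anti : antisymmetric (fun i j : 'I_N => i <= j).
Proof. by move=> i j; rewrite -eqn_leq => /eqP/val_inj. Qed.

Fact false_sub_leq : subrel (fun _ _ : 'I_N => false) (fun i j => i <= j).
Proof. by []. Qed.

Definition antichain : ordPoset :=
  @OrdPoset 'I_N (fun _ _ => false) (fun i j => i <= j)
    (fun=> erefl) (fun _ _ _ _ => id) (fun=> leqnn _) ord_leq_anti
    (fun _ _ _ => @leq_trans _ _ _) (fun _ _ => leq_total _ _)
    false_sub_leq.

End Antichain.

(** As the linear order is total, preserving it strictly suffices for reflecting
    it and for injectivity. *)
Lemma strict_embedding (P Q : ordPoset) (f : P -> Q) :
  (forall x y, prec (f x) (f y) = prec x y) ->
  (forall x y, x != y -> lin x y -> f x != f y /\ lin (f x) (f y)) ->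
  embedding (finfun f).
Proof.
move=> fR fL; have f_inj : injective f.
  move=> x y fxy; apply/eqP; apply: contraT => xy.
  have [/(fL _ _ xy)[/eqP//]|lyx] := orP (lin_total x y).
  by rewrite eq_sym in xy; have [] := fL _ _ xy lyx; rewrite fxy eqxx.
apply/embeddingP; split=> x y; rewrite !ffunE; [exact: f_inj | by rewrite fR |].
have [->|xy] := eqVneq x y; first by rewrite !lin_refl.
have [lxy|lyx] := orP (lin_total x y).
  by have [_ ->] := fL _ _ xy lxy.
have fxy : f y != f x by apply: contra_neq xy => /f_inj.
rewrite eq_sym in xy; have [_ lfyx] := fL _ _ xy lyx.
apply/idP/idP => l1.
  by case/eqP: xy; apply: lin_anti; rewrite lyx l1.
by case/eqP: fxy; apply: lin_anti; rewrite lfyx l1.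
Qed.

(** * Up-sets *)

Definition upset (P : ordPoset) (F : {set P}) : bool :=
  [forall x in F, forall y, prec x y ==> (y \in F)].

Lemma upsetP (P : ordPoset) (F : {set P}) :
  reflect (forall x y, x \in F -> prec x y -> y \in F) (upset F).
Proof.
apply: (iffP forall_inP) => up x.
  by move=> y xF xy; move: (up x xF) => /forallP/(_ y)/implyP; apply.
by move=> xF; apply/forallP => y; apply/implyP; apply: up.
Qed.

Definition up_closure (P : ordPoset) (A : {set P}) : {set P} :=
  [set z | [exists x in A, (z == x) || prec x z]].

Lemma up_closureP (P : ordPoset) (A : {set P}) z :
  reflect (exists2 x, x \in A & z = x \/ prec x z) (z \in up_closure A).
Proof.
rewrite inE; apply: (iffP exists_inP) => -[x xA].
  by move=> /predU1P xz; exists x.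
by move=> xz; exists x => //; apply/predU1P.
Qed.

Lemma up_closure_upset (P : ordPoset) (A : {set P}) : upset (up_closure A).
Proof.
apply/upsetP => x y /up_closureP[z zA zx] xy; apply/up_closureP; exists z => //.
by right; case: zx => [<-//|zx]; apply: prec_trans zx xy.
Qed.

Lemma sub_up_closure (P : ordPoset) (A : {set P}) : A \subset up_closure A.
Proof. by apply/subsetP => x xA; apply/up_closureP; exists x => //; left. Qed.

Lemma mem_up_closure1 (P : ordPoset) (x : P) : x \in up_closure [set x].
Proof. by apply: (subsetP (sub_up_closure _)); rewrite inE. Qed.

Lemma up_closure1_neq0 (P : ordPoset) (x : P) : up_closure [set x] != set0.
Proof. by apply/set0Pn; exists x; apply: mem_up_closure1. Qed.

Lemma up_closure_min (P : ordPoset) (A F : {set P}) :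
  upset F -> A \subset F -> up_closure A \subset F.
Proof.
move=> /upsetP upF /subsetP AF; apply/subsetP => z /up_closureP[x /AF xF].
by case=> [->//|]; apply: upF.
Qed.

Lemma subset_set_le (P : ordPoset) (X Y : {set P}) :
  X \subset Y -> lin (X : cube P) Y.
Proof.
move=> XY; rewrite /= /set_le; have [//|ne] := eqVneq X Y.
by rewrite set_lt_proper // properEneq ne.
Qed.

Definition upsets (P : ordPoset) : seq {set P} :=
  sort (@lin (cube P)) (filter (@upset P) (enum {set P})).

Lemma mem_upsets (P : ordPoset) (F : {set P}) : (F \in upsets P) = upset F.
Proof. by rewrite mem_sort mem_filter mem_enum andbT. Qed.

Lemma upsets_uniq (P : ordPoset) : uniq (upsets P).
Proof. by rewrite sort_uniq filter_uniq ?enum_uniq. Qed.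

Lemma index_upsets_lt (P : ordPoset) (E F : {set P}) : upset E -> upset F ->
  (index E (upsets P) < index F (upsets P)) = (E != F) && lin (E : cube P) F.
Proof.
rewrite -!mem_upsets => Es Fs.
have ss : sorted (@lin (cube P)) (upsets P) := sort_sorted (@lin_total _) _.
apply/idP/andP => [ltEF|[EF leEF]].
  split; first by apply: contraTneq ltEF => ->; rewrite ltnn.
  exact: (sorted_ltn_index (@lin_trans (cube P)) ss) ltEF.
rewrite ltnNge; apply: contra EF => leFE; apply/eqP.
apply: (@lin_anti (cube P)); rewrite leEF.
exact: (sorted_leq_index (@lin_trans (cube P)) (@lin_refl (cube P)) ss) leFE.
Qed.

Lemma upset0 (P : ordPoset) : upset (set0 : {set P}).
Proof. by apply/upsetP => x y; rewrite inE. Qed.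

Lemma index_upsets0 (P : ordPoset) : index set0 (upsets P) = 0.
Proof.
apply/eqP; rewrite -leqn0 leqNgt; apply/negP => lt0.
have s0 : 0 < size (upsets P) := leq_trans lt0 (index_size _ _).
have Fs : nth set0 (upsets P) 0 \in upsets P by apply: mem_nth.
have := @index_upsets_lt P (nth set0 (upsets P) 0) set0.
rewrite -!mem_upsets Fs mem_upsets upset0 => /(_ isT isT).
rewrite index_uniq ?upsets_uniq // lt0 => /esym/andP[ne le0].
case/eqP: ne; apply: (@lin_anti (cube P)); rewrite le0.
exact/subset_set_le/sub0set.
Qed.

(** * Words over up-sets and embeddings into cubes *)

Definition word_map (P : ordPoset) (N : nat) (w : seq nat) (x : P) :
    cube (antichain N) :=
  [set i : 'I_N | x \in nth set0 (upsets P) (nth 0 w i)].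

(** Among the up-sets separating [x] from a linearly later [y], the one
    generated by [y] comes first: those containing [y] include it, and those
    containing [x] own an element smaller than all of its elements. *)
Lemma principal_least (P : ordPoset) (x y : P) (F : {set P}) :
  x != y -> lin x y -> upset F -> (x \in F) != (y \in F) ->
  lin (up_closure [set y] : cube P) F.
Proof.
move=> xy lxy upF sep; have [yF|yF] := boolP (y \in F).
  by apply/subset_set_le/up_closure_min => //; rewrite sub1set.
rewrite (negPf yF) in sep.
have xF : x \in F by case: (x \in F) sep.
have [//|/predU1P[FE|]] := orP (@lin_total (cube P) (up_closure [set y]) F).
  by case/negP: yF; rewrite FE mem_up_closure1.
case/set_ltP => m [/up_closureP[y' /set1P-> my] mF agree].
have lym : lin y m by case: my => [->|/prec_lin//]; apply: lin_refl.
have xm : x != m by apply: contraNneq mF => <-.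
have := agree x xm (lin_trans lxy lym); rewrite xF.
case/esym/up_closureP=> y'' /set1P-> [xy'|/prec_lin lyx]; first by rewrite xy' eqxx in xy.
by case/eqP: xy; apply: lin_anti; rewrite lxy lyx.
Qed.

Lemma word_map_embedding (P : ordPoset) (N : nat) (w : seq nat) :
  size w = N -> param_word 1 (size (upsets P)) w ->
  embedding [ffun x : P => word_map N w x].
Proof.
move=> sw /param_wordP[_ wlt wmem first_occ].
pose fs := upsets P.
have upw i : i < N -> upset (nth set0 fs (nth 0 w i)).
  by move=> iN; rewrite -mem_upsets mem_nth // wlt // mem_nth ?sw.
(* Before the first occurrence of [F], neither [F] nor any up-set after it in
   the list has occurred. *)
have occ F : upset F -> F != set0 -> exists2 i : 'I_N, nth set0 fs (nth 0 w i) = F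
    & forall k : 'I_N, k < i -> lin (F : cube P) (nth set0 fs (nth 0 w k)) -> False.
  move=> upF F0; have Fs : F \in fs by rewrite mem_upsets.
  have lF : 0 < index F fs.
    rewrite -(index_upsets0 P) index_upsets_lt ?upset0 // eq_sym F0.
    exact/subset_set_le/sub0set.
  have lw : index F fs \in w by apply: wmem; rewrite ?index_mem.
  have iN : index (index F fs) w < N by rewrite -sw index_mem.
  exists (Ordinal iN) => /=; first by rewrite !nth_index.
  move=> k ki leF.
  have kw : k < size w by rewrite sw.
  have kne : nth 0 w k != index F fs by have /= -> := before_find 0 ki.
  have ks : nth 0 w k < size fs by apply: wlt; apply: mem_nth.
  have Fk : F != nth set0 fs (nth 0 w k).
    by apply: contraNneq kne => ->; rewrite index_uniq ?upsets_uniq.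
  have : index F fs < nth 0 w k.
    rewrite -[X in _ < X](index_uniq set0 ks (upsets_uniq P)).
    by rewrite index_upsets_lt ?upw // Fk.
  move/(first_occ k _ kw lF)/index_ltn.
  by rewrite ltnNge ltnW.
have in_map (x : P) (i : 'I_N) : (i \in word_map N w x) = (x \in nth set0 fs (nth 0 w i)).
  by rewrite inE.
have lt_map (x y : P) : x != y -> lin x y -> set_lt (word_map N w x) (word_map N w y).
  move=> xy lxy; have [i iF imin] := occ _ (up_closure_upset [set y]) (up_closure1_neq0 y).
  apply/set_ltP; exists i; rewrite !in_map iF; split.
  - exact: mem_up_closure1.
  - apply/up_closureP => -[y' /set1P-> [/eqP|/prec_lin lyx]]; first by rewrite (negPf xy).
    by case/eqP: xy; apply: lin_anti; rewrite lxy lyx.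
  move=> k ki lki; rewrite !in_map; apply/eqP; apply: contraT => sep.
  case: (imin k); first by rewrite ltn_neqAle ki.
  exact: principal_least xy lxy (upw _ (ltn_ord k)) sep.
apply: strict_embedding => x y; last first.
  move=> xy lxy; have lt := lt_map x y xy lxy; rewrite /= /set_le lt orbT.
  by split=> //; apply: contraTneq lt => ->; rewrite set_lt_irr.
apply/idP/idP => /= [/properP[/subsetP sxy [i iy ix]]|xy].
  have [k kF _] := occ _ (up_closure_upset [set x]) (up_closure1_neq0 x).
  have : k \in word_map N w x.
    by rewrite in_map kF mem_up_closure1.
  move/sxy; rewrite in_map kF => /up_closureP[x' /set1P-> [yx|//]].
  by rewrite yx (negPf ix) in iy.
rewrite properEneq; apply/andP; split.
  have ne : x != y by apply: contraTneq xy => ->; rewrite prec_irr.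
  by apply: contraTneq (lt_map x y ne (prec_lin xy)) => ->; rewrite set_lt_irr.
apply/subsetP => i; rewrite !in_map => xi.
exact: (upsetP _ (upw _ (ltn_ord i))) xi xy.
Qed.

Definition pullback_word (P Q : ordPoset) (g : P -> Q) : seq nat :=
  [seq index (g @^-1: F) (upsets P) | F : {set Q} <- upsets Q].

Lemma preim_upset (P Q : ordPoset) (g : {ffun P -> Q}) (F : {set Q}) :
  embedding g -> upset F -> upset (g @^-1: F).
Proof.
move=> /embeddingP[_ gR _] /upsetP upF; apply/upsetP => x y.
by rewrite !inE gR; apply: upF.
Qed.

Lemma preim_up_closure (P Q : ordPoset) (g : {ffun P -> Q}) (E : {set P}) :
  embedding g -> upset E -> g @^-1: up_closure (g @: E) = E.
Proof.
move=> /embeddingP[g_inj gR _] /upsetP upE; apply/setP => x; rewrite inE.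
apply/up_closureP/idP => [[_ /imsetP[y yE ->]]|xE].
  by case=> [/g_inj->//|]; rewrite -gR; apply: upE.
by exists (g x); [apply: imset_f | left].
Qed.

(** The order on up-sets is decided from below, and an element of the closure
    lying below [g m] is generated by images of elements below [m], where the
    two up-sets agree.  The order deciding from above lacks this property. *)
Lemma up_closure_mono (P Q : ordPoset) (g : {ffun P -> Q}) (E F : {set P}) :
  embedding g -> upset E -> upset F -> set_lt E F ->
  set_lt (up_closure (g @: E)) (up_closure (g @: F)).
Proof.
move=> eg upE upF /set_ltP[m [mF mE agree]].
have [g_inj gR gL] := embeddingP _ eg.
have in_closure A x : upset A -> (g x \in up_closure (g @: A)) = (x \in A).
  by move=> upA; rewrite -[in RHS](preim_up_closure eg upA) [RHS]inE.
have below z (A B : {set P}) : z != g m -> lin z (g m) ->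
    (forall x, x != m -> lin x m -> (x \in A) = (x \in B)) ->
    z \in up_closure (g @: A) -> z \in up_closure (g @: B).
  move=> zm lzm AB /up_closureP[_ /imsetP[x xA ->] zx].
  have lxz : lin (g x) z by case: zx => [->|/prec_lin//]; apply: lin_refl.
  apply/up_closureP; exists (g x); last exact: zx.
  apply: imset_f.
  rewrite -AB // ?gL ?(lin_trans lxz lzm) //.
  apply: contra_neq zm => xm; apply: lin_anti; rewrite lzm -xm lxz //.
apply/set_ltP; exists (g m); rewrite !in_closure //; split=> // z zm lzm.
by apply/idP/idP; apply: below => // x xm lxm; rewrite agree.
Qed.

(** Among the up-sets of [Q] with preimage [E], the closure of the image of [E]
    is the smallest and hence the first in the list, so that first occurrences
    are in the right order by [up_closure_mono]. *)
Lemma param_word_pullback (P Q : ordPoset) (g : {ffun P -> Q}) : embedding g ->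
  param_word 0 (size (upsets P)) (pullback_word g).
Proof.
move=> eg; have up_preim F := preim_upset (F := F) eg.
apply/param_wordP; split=> // [l|l _ lb|q l].
- by case/mapP=> F; rewrite mem_upsets => upF ->; rewrite index_mem mem_upsets up_preim.
- apply/mapP; have := mem_nth set0 lb; rewrite mem_upsets => upE.
  exists (up_closure (g @: nth set0 (upsets P) l)).
    by rewrite mem_upsets up_closure_upset.
  by rewrite preim_up_closure // index_uniq ?upsets_uniq.
rewrite size_map => qs _; rewrite (nth_map set0) //.
set F := nth set0 _ q => lF.
have upF : upset F by rewrite -mem_upsets mem_nth.
have ls : l < size (upsets P).
  by apply: leq_trans lF _; apply: index_size.
pose E := nth set0 (upsets P) l.
have upE : upset E by rewrite -mem_upsets mem_nth.
have lE : index E (upsets P) = l by rewrite index_uniq ?upsets_uniq.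
pose G := up_closure (g @: E).
have upG : upset G by apply: up_closure_upset.
have Gs : G \in upsets Q by rewrite mem_upsets.
move: lF; rewrite -lE index_upsets_lt ?up_preim // => /andP[ne /predU1P[/eqP|ltE]].
  by rewrite (negPf ne).
have GF : index G (upsets Q) < q.
  rewrite -(index_uniq set0 qs (upsets_uniq Q)) index_upsets_lt // -/F.
  have ltG : set_lt G (up_closure (g @: (g @^-1: F))).
    by apply: up_closure_mono => //; apply: up_preim.
  apply/andP; split.
    by apply: contraNneq ne => <-; rewrite preim_up_closure.
  have leG : lin (G : cube Q) (up_closure (g @: (g @^-1: F))).
    by rewrite /= /set_le ltG orbT.
  apply: lin_trans leG (subset_set_le _).
  apply: up_closure_min => //; apply/subsetP => _ /imsetP[x xF ->].
  by rewrite inE in xF.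
have -> : index E (upsets P) = nth 0 (pullback_word g) (index G (upsets Q)).
  by rewrite (nth_map set0) ?index_mem // nth_index // preim_up_closure.
by rewrite -(nth_take 0 GF) mem_nth // size_takel ?size_map // ltnW.
Qed.

Lemma word_map_pullback (P Q : ordPoset) (g : P -> Q) N u x :
  size u = N -> all (fun l => l < size (upsets Q)) u ->
  (forall F, upset F -> upset (g @^-1: F)) ->
  word_map N (map (nth 0 (pullback_word g)) u) x = word_map N u (g x).
Proof.
move=> su /allP uQ up_preim; apply/setP => i; rewrite !inE.
have lt : nth 0 u i < size (upsets Q) by apply: uQ; rewrite mem_nth ?su.
have upF : upset (nth set0 (upsets Q) (nth 0 u i)) by rewrite -mem_upsets mem_nth.
rewrite (nth_map 0) ?su // (nth_map set0) // nth_index ?mem_upsets ?up_preim //.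
by rewrite inE.
Qed.

Lemma pullback_word_cons (P Q : ordPoset) (g : P -> Q) :
  pullback_word g = 0 :: behead (pullback_word g).
Proof.
have := index_upsets0 Q; rewrite /pullback_word.
have : set0 \in upsets Q by rewrite mem_upsets upset0.
case: (upsets Q) => [//|F fs] _ /=; case: eqP => // -> _.
by rewrite preimset0 index_upsets0.
Qed.

Lemma size_upsets_gt0 (P : ordPoset) : 0 < size (upsets P).
Proof.
by rewrite lt0n size_eq0; apply: contraTneq (upset0 P); rewrite -mem_upsets => ->.
Qed.

Theorem theorem1p1 : ramsey_class all_ordPosets.
Proof.
move=> P Q _ _ r r0.
have [N hN] := @graham_rothschild 1 (size (upsets P)).-1 isT
  'I_r (size (upsets Q)).-1.
pose S := cube (antichain N); exists S => // chi.
pose colour (A : {set S}) : 'I_r :=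
  if insub A is Some A' then chi A' else Ordinal r0.
have [u [i [su pu cu]]] := hN (fun w => colour [set word_map N w x | x : P]).
rewrite !add1n !prednK ?size_upsets_gt0 // in pu cu.
have eu : embedding [ffun y : Q => word_map N u y : S].
  exact: word_map_embedding pu.
pose fu := [ffun y : Q => word_map N u y : S].
have Bcopy : [set fu y | y : Q] \in copies S Q by apply: imset_f; rewrite inE.
(* The copies of [P] in this copy of [Q] come from embeddings [h] of [P] into
   [Q], hence from words obtained from [u] by substituting pulled-back words. *)
exists (exist (fun B => B \in copies S Q) _ Bcopy) => /=.
suff mono A : chi (@lift_copy S P [set fu y | y : Q] A) = i by move=> A1 A2; rewrite !mono.
have -> : chi (lift_copy A) = colour (val (lift_copy A)) by rewrite /colour valK.
case: A => A /= /imsetP[g]; rewrite inE => /embeddingP[g_inj gR gL] ->.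
have [_ fuR fuL] := embeddingP _ eu.
have pre x : exists y, val (g x) == fu y.
  by have /imsetP[y _ ->] := valP (g x); exists y.
pose h := [ffun x => xchoose (pre x)].
have hE x : val (g x) = fu (h x) by rewrite [h x]ffunE; apply/eqP/(xchooseP (pre x)).
have eh : embedding h.
  apply/embeddingP; split=> x y.
  - by move=> hxy; apply/g_inj/val_inj; rewrite !hE hxy.
  - by rewrite fuR -!hE gR.
  - by rewrite fuL -!hE gL.
have ph := param_word_pullback eh.
rewrite pullback_word_cons in ph.
rewrite -(cu (behead (pullback_word h))) //; last 1 first.
  by rewrite size_behead size_map.
rewrite -imset_comp; congr (colour _); apply: eq_imset => x /=.
rewrite hE ffunE -(word_map_pullback _ su (param_word_lt pu) (fun F => preim_upset eh)).
by rewrite [pullback_word h]pullback_word_cons.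
Qed.
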